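(* Let $n\ge2$ and let $\widetilde{\boldsymbol N}_{n,2,0}$ be the free $\mathbb Z[q^{\pm1},s^{\pm1}][t]$-module (where $q,s,t$ are indeterminates) with basis the $\binom n2+1$ vectors $b$ and $w_{i,j}$, $1\le i<j\le n$. Then $\widetilde{\boldsymbol N}_{n,2,0}$ is a representation of the braid group $B_n$, where the Artin generators $\sigma_1,\dots,\sigma_{n-1}$ act by $\sigma_i w_{j,k}=w_{j,k}$ if $\{i,i+1\}\cap\{j,k\}=\emptyset$; $\sigma_i w_{i+1,j}=s^{-1}w_{i,j}$ ($j>i+1$); $\sigma_i w_{j,i+1}=s^{-1}w_{j,i}$ ($j<i$); $\sigma_i w_{i,j}=s^{-1}w_{i+1,j}+(1-s^{-2})w_{i,j}-s^{i-j-1}(1-s^{-2})q^2w_{i,i+1}$ ($j>i+1$); $\sigma_i w_{i,i+1}=s^{-4}q^2w_{i,i+1}$; $\sigma_i w_{j,i}=s^{-1}w_{j,i+1}+(1-s^{-2})w_{j,i}-s^{i-j-1}(1-s^{-2})w_{i,i+1}$ ($j<i$); and $$\sigma_i b=b+t\,w_{i,i+1}.$$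
   Context: $B_n$ is the braid group on $n$ strands with its standard presentation by $\sigma_1,\dots,\sigma_{n-1}$. The formulas on the $w_{i,j}$ are those of the two-variable Lawrence–Krammer–Bigelow representation. *)

(* Defs.v *)
From HB Require Import structures.
From mathcomp Require Import all_boot all_order all_algebra fraction.
From mathcomp Require Import boolp.

Set Implicit Arguments.
Unset Strict Implicit.
Unset Printing Implicit Defensive.

Import GRing.Theory.
Local Open Scope ring_scope.
Local Open Scope quotient_scope.

Section PresentedGroup.
Variable X : choiceType.

(* The letter (x, true) stands for x and (x, false) for x^-1. *)
Definition word := seq (X * bool).

Definition inv_letter (a : X * bool) := (a.1, ~~ a.2).
Definition inv_word (u : word) : word := rev (map inv_letter u).

Variable rels : word -> word -> Prop.

Inductive word_eqv : word -> word -> Prop :=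
| word_rel u v : rels u v -> word_eqv u v
| word_cancel a : word_eqv [:: a; inv_letter a] [::]
| word_cat u u' v v' :
    word_eqv u u' -> word_eqv v v' -> word_eqv (u ++ v) (u' ++ v')
| word_refl u : word_eqv u u
| word_sym u v : word_eqv u v -> word_eqv v u
| word_trans u v w : word_eqv u v -> word_eqv v w -> word_eqv u w.

Definition word_eqvb : rel word := fun u v => `[< word_eqv u v >].

Lemma word_eqvb_refl : reflexive word_eqvb.
Proof. by move=> u; apply/asboolP; exact: word_refl. Qed.

Lemma word_eqvb_sym : symmetric word_eqvb.
Proof. by move=> u v; apply/asboolP/asboolP; exact: word_sym. Qed.

Lemma word_eqvb_trans : transitive word_eqvb.
Proof.
move=> v u w /asboolP uv /asboolP vw; apply/asboolP.
exact: word_trans uv vw.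
Qed.

Canonical word_equiv :=
  EquivRel word_eqvb word_eqvb_refl word_eqvb_sym word_eqvb_trans.

Definition presented := {eq_quot word_equiv}.
HB.instance Definition _ := Choice.on presented.

Definition word_class (u : word) : presented := \pi_presented u.

Lemma word_classP u v : word_class u = word_class v <-> word_eqv u v.
Proof.
split; first by move/eqmodP => /asboolP.
by move=> uv; apply/eqmodP/asboolP.
Qed.

Lemma word_class_ind (P : presented -> Prop) :
  (forall u, P (word_class u)) -> forall x, P x.
Proof. by move=> Pu x; rewrite -[x]reprK; exact: Pu. Qed.

Lemma word_eqv_repr u : word_eqv (repr (word_class u)) u.
Proof. by apply/word_classP; exact: reprK. Qed.

Lemma inv_letterK : involutive inv_letter.
Proof. by case=> x b; rewrite /inv_letter /= negbK. Qed.

Lemma inv_word_cat u v : inv_word (u ++ v) = inv_word v ++ inv_word u.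
Proof. by rewrite /inv_word map_cat rev_cat. Qed.

Lemma inv_wordK : involutive inv_word.
Proof.
move=> u; rewrite /inv_word map_rev revK -map_comp -[RHS]map_id.
by apply: eq_map => a /=; rewrite inv_letterK.
Qed.

Lemma word_cancelV u : word_eqv (u ++ inv_word u) [::].
Proof.
elim: u => [|a u IHu]; first exact: word_refl.
rewrite /inv_word map_cons rev_cons -cats1 -/(inv_word u) -cat1s.
rewrite -catA (catA u).
apply: word_trans (word_cancel a).
rewrite -[[:: a; inv_letter a]]/([:: a] ++ ([::] ++ [:: inv_letter a])).
do 2?[apply: word_cat; try exact: word_refl].
exact: IHu.
Qed.

Lemma inv_word_eqv u v : word_eqv u v -> word_eqv (inv_word u) (inv_word v).
Proof.
move=> uv.
apply: (@word_trans _ (inv_word u ++ (v ++ inv_word v))).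
  rewrite -{1}[inv_word u]cats0; apply: word_cat; first exact: word_refl.
  exact/word_sym/word_cancelV.
rewrite catA -{2}[inv_word v]cat0s; apply: word_cat; last exact: word_refl.
apply: (@word_trans _ (inv_word u ++ u)).
  by apply: word_cat; [exact: word_refl | exact: word_sym].
by rewrite -{2}[u]inv_wordK; exact: word_cancelV.
Qed.

Definition presented_one : presented := word_class [::].
Definition presented_mul (x y : presented) : presented :=
  word_class (repr x ++ repr y).
Definition presented_inv (x : presented) : presented :=
  word_class (inv_word (repr x)).

Lemma presented_mulE u v :
  presented_mul (word_class u) (word_class v) = word_class (u ++ v).
Proof. by apply/word_classP; apply: word_cat; exact: word_eqv_repr. Qed.

Lemma presented_invE u :
  presented_inv (word_class u) = word_class (inv_word u).
Proof. by apply/word_classP; apply: inv_word_eqv; exact: word_eqv_repr. Qed.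

Lemma presented_mulA : associative presented_mul.
Proof.
elim/word_class_ind=> u; elim/word_class_ind=> v; elim/word_class_ind=> w.
by rewrite !presented_mulE catA.
Qed.

Lemma presented_mul1g : left_id presented_one presented_mul.
Proof. by elim/word_class_ind=> u; rewrite presented_mulE. Qed.

Lemma presented_mulg1 : right_id presented_one presented_mul.
Proof. by elim/word_class_ind=> u; rewrite presented_mulE cats0. Qed.

Lemma presented_mulgV : right_inverse presented_one presented_inv presented_mul.
Proof.
elim/word_class_ind=> u; rewrite presented_invE presented_mulE.
by apply/word_classP; exact: word_cancelV.
Qed.

Lemma presented_mulVg : left_inverse presented_one presented_inv presented_mul.
Proof.
elim/word_class_ind=> u; rewrite presented_invE presented_mulE.
by apply/word_classP; rewrite -{2}[u]inv_wordK; exact: word_cancelV.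
Qed.

HB.instance Definition _ := isGroup.Build presented
  presented_mulA presented_mul1g presented_mulg1
  presented_mulVg presented_mulgV.

Definition presented_gen (x : X) : presented := word_class [:: (x, true)].

End PresentedGroup.

(* Strands are numbered 0, ..., n-1 and Artin generators 0, ..., n-2, so that
   the mathematical sigma_i is the generator of index i-1. *)
Section BraidGroup.
Variable n : nat.

Local Notation s i := (i, true).

Inductive braid_rel : word 'I_n.-1 -> word 'I_n.-1 -> Prop :=
| braid_far (i j : 'I_n.-1) : (i.+1 < j)%N ->
    braid_rel [:: s i; s j] [:: s j; s i]
| braid_near (i j : 'I_n.-1) : j = i.+1 :> nat ->
    braid_rel [:: s i; s j; s i] [:: s j; s i; s j].

Definition braid : groupType := presented braid_rel.

Definition artin (i : 'I_n.-1) : braid := presented_gen braid_rel i.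

End BraidGroup.

(* Z[q^+-1, s^+-1] is realized inside the fraction field of Z[q][s] as the set of all
   p / (q^k s^l) with p in Z[q][s]. *)
Definition qs_field : fieldType := {fraction {poly {poly int}}}.
Definition fracq : qs_field := tofrac ('X%:P : {poly {poly int}}).
Definition fracs : qs_field := tofrac ('X : {poly {poly int}}).

Definition laurent_pred : {pred qs_field} := fun x =>
  `[< exists (p : {poly {poly int}}) (k l : nat),
        x = tofrac p / (fracq ^+ k * fracs ^+ l) >].

Lemma fracq_neq0 : fracq != 0.
Proof. by rewrite tofrac_eq0 polyC_eq0 polyX_eq0. Qed.

Lemma fracs_neq0 : fracs != 0.
Proof. by rewrite tofrac_eq0 polyX_eq0. Qed.

Lemma laurentP x :
  reflect (exists (p : {poly {poly int}}) (k l : nat),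
             x = tofrac p / (fracq ^+ k * fracs ^+ l)) (x \in laurent_pred).
Proof. exact: asboolP. Qed.

Lemma subf_div (F : fieldType) (a b c d : F) :
  b != 0 -> d != 0 -> a / b - c / d = (a * d - c * b) / (b * d).
Proof. by move=> b0 d0; rewrite -mulNr addf_div // mulNr. Qed.

Fact laurent_subring : subring_closed laurent_pred.
Proof.
split=> [|x y|x y].
- by apply/laurentP; exists 1, 0, 0; rewrite !expr0 mulr1 invr1 mulr1 rmorph1.
- move=> /laurentP[p [k [l ->]]] /laurentP[p' [k' [l' ->]]].
  apply/laurentP; exists (p * ('X%:P ^+ k' * 'X ^+ l')
                          - p' * ('X%:P ^+ k * 'X ^+ l)), (k + k')%N, (l + l')%N.
  rewrite rmorphB !rmorphM !rmorphXn /= -/fracq -/fracs !exprD.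
  have q0 m : fracq ^+ m != 0 by rewrite expf_neq0 // fracq_neq0.
  have s0 m : fracs ^+ m != 0 by rewrite expf_neq0 // fracs_neq0.
  by rewrite subf_div ?mulf_neq0 // [in RHS]mulrACA.
- move=> /laurentP[p [k [l ->]]] /laurentP[p' [k' [l' ->]]].
  apply/laurentP; exists (p * p'), (k + k')%N, (l + l')%N.
  by rewrite mulf_div rmorphM !exprD mulrACA.
Qed.

HB.instance Definition _ :=
  GRing.isSubringClosed.Build qs_field laurent_pred laurent_subring.

Record laurent := Laurent {
  laurent_val :> qs_field;
  _ : laurent_val \in laurent_pred }.

HB.instance Definition _ := [isSub for laurent_val].
HB.instance Definition _ := [Choice of laurent by <:].
HB.instance Definition _ := [SubChoice_isSubComNzRing of laurent by <:].

(* Units and inverses in laurent are those of the ring laurent itself;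
   x^-1 is x when x is not invertible in it. *)
Section LaurentUnits.

Definition laurent_unit : {pred laurent} := fun x =>
  `[< exists y : laurent, y * x = 1 >].

Definition laurent_inv (x : laurent) : laurent :=
  if pselect (exists y : laurent, y * x = 1) is left h then sval (cid h) else x.

Fact laurent_mulVr : {in laurent_unit, left_inverse 1 laurent_inv *%R}.
Proof.
move=> x /asboolP hx; rewrite /laurent_inv.
by case: pselect => // h; exact: svalP (cid h).
Qed.

Fact laurent_unitP (x y : laurent) : y * x = 1 -> laurent_unit x.
Proof. by move=> yx; apply/asboolP; exists y. Qed.

Fact laurent_inv_out : {in [predC laurent_unit], laurent_inv =1 id}.
Proof.
move=> x /negP hx; rewrite /laurent_inv; case: pselect => // h.
by case: hx; apply/asboolP.
Qed.

HB.instance Definition _ := GRing.ComNzRing_hasMulInverse.Build laurent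
  laurent_mulVr laurent_unitP laurent_inv_out.

End LaurentUnits.

Fact laurent_q_subproof : fracq \in laurent_pred.
Proof.
by apply/laurentP; exists 'X%:P, 0, 0; rewrite !expr0 mulr1 invr1 mulr1.
Qed.

Fact laurent_s_subproof : fracs \in laurent_pred.
Proof. by apply/laurentP; exists 'X, 0, 0; rewrite !expr0 mulr1 invr1 mulr1. Qed.

Definition lq : laurent := Laurent laurent_q_subproof.
Definition ls : laurent := Laurent laurent_s_subproof.

Lemma lq_unit : lq \is a GRing.unit.
Proof.
have h : fracq^-1 \in laurent_pred.
  by apply/laurentP; exists 1, 1, 0; rewrite expr0 expr1 mulr1 rmorph1 mul1r.
apply/asboolP; exists (Laurent h); apply: val_inj.
by rewrite rmorphM rmorph1 /= mulVf ?fracq_neq0.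
Qed.

Lemma ls_unit : ls \is a GRing.unit.
Proof.
have h : fracs^-1 \in laurent_pred.
  by apply/laurentP; exists 1, 0, 1; rewrite expr0 expr1 mul1r rmorph1 mul1r.
apply/asboolP; exists (Laurent h); apply: val_inj.
by rewrite rmorphM rmorph1 /= mulVf ?fracs_neq0.
Qed.

(* None indexes b, and Some (j, k) with j < k indexes w_{j,k}. *)
Definition lkb_index (n : nat) : finType :=
  option {p : 'I_n * 'I_n | (p.1 < p.2)%N}.

Definition lkb_module (n : nat) : lmodType {poly laurent} :=
  {ffun lkb_index n -> {poly laurent}^o}.

Lemma card_lkb_index n : #|lkb_index n| = ('C(n, 2)).+1.
Proof.
rewrite card_option card_sig -bin2_sum big_mkord -sum1_card; congr _.+1.
rewrite (eq_bigl (fun p : 'I_n * 'I_n => true && (p.1 < p.2)%N)) //.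
rewrite -(pair_big_dep xpredT (fun j k : 'I_n => (j < k)%N) (fun _ _ => 1%N)).
rewrite (exchange_big_dep xpredT) //=; apply: eq_bigr => k _.
by rewrite -(big_ord_widen n (fun=> 1%N)) ?sum1_card ?card_ord // ltnW.
Qed.

Section LKBBasis.
Variable n : nat.

Definition lkb_vec (x : lkb_index n) : lkb_module n :=
  [ffun y => (y == x)%:R].

Lemma lkb_vec_span (v : lkb_module n) : v = \sum_x v x *: lkb_vec x.
Proof.
apply/ffunP => y; rewrite sum_ffunE (bigD1 y) //= big1 => [|x xy].
  by rewrite !ffunE eqxx addr0 [RHS]mulr1.
by rewrite !ffunE eq_sym (negbTE xy) [LHS]mulr0.
Qed.

Lemma lkb_vec_free (c : lkb_index n -> {poly laurent}) :
  \sum_x c x *: lkb_vec x = 0 -> forall x, c x = 0.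
Proof.
move=> c0 y; move/ffunP/(_ y): c0.
rewrite sum_ffunE (bigD1 y) //= big1 => [|x xy].
  by rewrite !ffunE eqxx addr0 => cy; rewrite -[LHS]mulr1; exact: cy.
by rewrite !ffunE eq_sym (negbTE xy) [LHS]mulr0.
Qed.

Definition lkb_b : lkb_module n := lkb_vec None.

(* A basis vector when j < k; the value 0 otherwise is never used. *)
Definition lkb_w (j k : 'I_n) : lkb_module n :=
  if insub (j, k) is Some p then lkb_vec (Some p) else 0.

Lemma lkb_wE (j k : 'I_n) (jk : (j < k)%N) :
  lkb_w j k =
    lkb_vec (Some (Sub (j, k) jk : {p : 'I_n * 'I_n | (p.1 < p.2)%N})).
Proof. by rewrite /lkb_w insubT. Qed.

(* The two strands exchanged by the i-th Artin generator. *)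
Definition strand (i : 'I_n.-1) : 'I_n := widen_ord (leq_pred n) i.

Fact strandS_subproof (i : 'I_n.-1) : (i.+1 < n)%N.
Proof. by rewrite -ltn_predRL. Qed.

Definition strandS (i : 'I_n.-1) : 'I_n := Ordinal (strandS_subproof i).

End LKBBasis.

Arguments lkb_b : clear implicits.

Definition is_representation (G : groupType) (R : nzRingType) (V : lmodType R)
    (rho : G -> {linear V -> V}) : Prop :=
  (forall v, rho 1%g v = v) /\ (forall x y v, rho (x * y)%g v = rho x (rho y v)).

(* Main.v *)
(** In the rescaled basis [w'_{j,k} = s^(j+k) w_{j,k}] the dependence on the
    positions of the strands disappears: on the [w'_{j,k}] the generators act
    with coefficients in [x = s^-2] and [y = q^2] only, while
    [sigma_i b = b + t_i w'_{i,i+1}] with [t_{i+1} = x t_i].  The braid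
    relations and the invertibility of the generators are then polynomial
    identities in [x], [y] and the [t_i], one for each relative position of
    [j], [k] and the exchanged strands. *)

Require Import Defs.
From HB Require Import structures.
From mathcomp Require Import all_boot all_order all_algebra zify ring.

Set Implicit Arguments.
Unset Strict Implicit.
Unset Printing Implicit Defensive.

Import GRing.Theory.
Local Open Scope ring_scope.

(** * Linearity rules for maps given as bare functions *)

Section LinearMorph.
Variables (R : comNzRingType) (V : lmodType R) (T : V -> V).
Hypothesis L : linear T.
Let T' : {linear V -> V} := HB.pack T (GRing.isLinear.Build R V V *:%R T L).

Lemma linear_morphD u v : T (u + v) = T u + T v.
Proof. exact: (linearD T'). Qed.
Lemma linear_morphN u : T (- u) = - T u.
Proof. exact: (linearN T'). Qed.
Lemma linear_morphZ a u : T (a *: u) = a *: T u.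
Proof. exact: (linearZZ T'). Qed.
End LinearMorph.

(** * Braid relations and inverses in the rescaled basis *)

Section RescaledAction.
Variables (R : comNzRingType) (I : finType) (n : nat).
Local Notation V := {ffun I -> R^o}.
Variables (w : nat -> nat -> V) (b : V) (x y : R) (t : nat -> R).

(** Positions are natural numbers, so that [lia] decides every branch once the relative position of
    [j], [k] and [i] is fixed. *)
Definition scaled_sigma (i j k : nat) : V :=
  if j == i then
    if k == i.+1 then (x ^+ 2 * y) *: w i i.+1
    else x *: w i.+1 k + (1 - x) *: w i k - (x * (1 - x) * y) *: w i i.+1
  else if j == i.+1 then w i k
  else if k == i.+1 then w j i
  else if k == i then
    x *: w j i.+1 + (1 - x) *: w j i - (x * (1 - x)) *: w i i.+1
  else w j k.

Definition acts_as_sigma (i : nat) (T : V -> V) : Prop :=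
  (forall j k, (j < k < n)%N -> T (w j k) = scaled_sigma i j k) /\
  T b = b + t i *: w i i.+1.

(** The inverse of [scaled_sigma], with [x'] and [y'] standing for the inverses of [x] and [y]. The
    branch [j == i.+1] comes from solving the formula for [w i k] for the preimage of [w i.+1 k],
    using [- x' * (1 - x) = 1 - x']; the branch [k == i.+1] is alike. *)
Definition scaled_sigmaV (x' y' : R) (i j k : nat) : V :=
  if j == i then
    if k == i.+1 then (x' ^+ 2 * y') *: w i i.+1 else w i.+1 k
  else if j == i.+1 then
    x' *: w i k + (1 - x') *: w i.+1 k + (x' ^+ 2 * (1 - x)) *: w i i.+1
  else if k == i.+1 then
    x' *: w j i + (1 - x') *: w j i.+1
    + (x' ^+ 2 * (1 - x) * y') *: w i i.+1
  else if k == i then w j i.+1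
  else w j k.

Definition acts_as_sigmaV (x' y' : R) (i : nat) (T : V -> V) : Prop :=
  (forall j k, (j < k < n)%N -> T (w j k) = scaled_sigmaV x' y' i j k) /\
  T b = b - (t i * (x' ^+ 2 * y')) *: w i i.+1.

Ltac decide_eqs E :=
  repeat match type of E with context [?a == ?c] =>
    let Eac := fresh in
    first [ have Eac : (a == c) = true by lia
          | have Eac : (a == c) = false by lia ];
    rewrite {}Eac in E
  end.

Ltac compute_action :=
  repeat match goal with
    | A : forall j k, is_true _ -> ?T (w j k) = _ |- context [?T (w ?j ?k)] =>
        let E := fresh in
        have E := A j k ltac:(lia);
        rewrite /scaled_sigma /scaled_sigmaV in E; decide_eqs E;
        rewrite {}E
    | B : ?T b = _ |- context [?T b] => rewrite B
    | L : linear ?T |- context [?T (_ + _)] => rewrite (linear_morphD L)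
    | L : linear ?T |- context [?T (- _)] => rewrite (linear_morphN L)
    | L : linear ?T |- context [?T (_ *: _)] => rewrite (linear_morphZ L)
    end.

Ltac split_on a c :=
  have [?|?] := eqVneq a c; try (exfalso; lia).

(** [T] fixes [w l l.+1] and [U] fixes [w i i.+1], so either order adds
    [t i *: w i i.+1 + t l *: w l l.+1] to [b]. *)
Lemma sigma_far (i l : nat) (T U : V -> V) :
    linear T -> linear U -> (i.+1 < l)%N -> (l.+1 < n)%N ->
    acts_as_sigma i T -> acts_as_sigma l U ->
  (forall j k, (j < k < n)%N -> T (U (w j k)) = U (T (w j k))) /\
  T (U b) = U (T b).
Proof.
move=> TL UL il ln [Tw Tb] [Uw Ub]; split=> [j k jk|].
  (* Each consistent position leaves an identity of vectors. At a coordinate [z] the scaling of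
     [R^o] is multiplication, so it becomes an identity for [ring] in [R]. *)
  split_on j i; split_on j i.+1; split_on j l; split_on j l.+1;
  split_on k i; split_on k i.+1; split_on k l; split_on k l.+1;
  subst; compute_action; apply/ffunP=> z;
  rewrite ?ffunE /GRing.scale /=; ring.
compute_action; apply/ffunP=> z; rewrite ?ffunE /GRing.scale /=; ring.
Qed.

Hypothesis tS : forall i, t i.+1 = x * t i.

(** On [b] the coefficient of [w i i.+2] is [t i.+1] on the left and [x * t i] on the right, which
    is where [tS] comes from. Both sides then add [t i] times [w i i.+1 + x *: w i i.+2 + x ^+ 2 *:
    w i.+1 i.+2]. *)
Lemma sigma_near (i : nat) (T U : V -> V) :
    linear T -> linear U -> (i.+2 < n)%N ->
    acts_as_sigma i T -> acts_as_sigma i.+1 U ->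
  (forall j k, (j < k < n)%N -> T (U (T (w j k))) = U (T (U (w j k)))) /\
  T (U (T b)) = U (T (U b)).
Proof.
move=> TL UL ln [Tw Tb] [Uw Ub]; split=> [j k jk|].
  split_on j i; split_on j i.+1; split_on j i.+2;
  split_on k i; split_on k i.+1; split_on k i.+2;
  subst; compute_action; apply/ffunP=> z;
  rewrite ?ffunE /GRing.scale /=; ring.
compute_action; apply/ffunP=> z; rewrite ?ffunE /GRing.scale /= tS; ring.
Qed.

Lemma sigmaK (x' y' : R) (i : nat) (T U : V -> V) :
    linear T -> linear U -> x' * x = 1 -> y' * y = 1 -> (i.+1 < n)%N ->
    acts_as_sigma i T -> acts_as_sigmaV x' y' i U ->
  (forall j k, (j < k < n)%N ->
     U (T (w j k)) = w j k /\ T (U (w j k)) = w j k) /\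
  (U (T b) = b /\ T (U b) = b).
Proof.
move=> TL UL xx yy ln [Tw Tb] [Uw Ub].
split=> [j k jk|].
  split_on j i; split_on j i.+1; split_on k i; split_on k i.+1;
  subst; split; compute_action; apply/ffunP=> z;
  rewrite ?ffunE /GRing.scale /=; ring: xx yy.
split; compute_action; apply/ffunP=> z;
rewrite ?ffunE /GRing.scale /=; ring: xx yy.
Qed.
End RescaledAction.

(** * Powers of [s] on the way back to the original basis *)

Section Unscaling.
Variables (R : comUnitRingType) (s q : R) (V : lmodType {poly R}).
Hypothesis sU : s \is a GRing.unit.
Implicit Types (c : R) (u v : V).

Lemma mul_polyC_exprVD (a b : nat) (p : {poly R}) :
  (s ^- (a + b))%:P * p = (s ^- a)%:P * ((s ^- b)%:P * p).
Proof. by rewrite mulrA -polyCM -!exprVn exprD. Qed.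

Lemma scale_exprV_expr (a b : nat) (m : int) c v :
    b%:Z - a%:Z = m ->
  (s ^- a)%:P *: (c%:P *: ((s ^+ b)%:P *: v)) = (s ^ m * c)%:P *: v.
Proof.
move=> <-; rewrite !scalerA -!polyCM; congr (_%:P *: _).
by rewrite exprzDr // -exprnN -exprnP; ring.
Qed.

Lemma scale_exprV_step (a : nat) v :
  (s ^- a.+1)%:P *: ((s ^+ a)%:P *: v) = (s^-1)%:P *: v.
Proof.
rewrite scalerA -polyCM; congr (_%:P *: _).
by rewrite exprSr invrM ?unitrX // -mulrA mulVr ?unitrX ?mulr1.
Qed.

Lemma expr_stepV : s ^ 1 * s ^- 2 = s^-1.
Proof. by rewrite expr1z exprSr expr1 invrM // mulVKr. Qed.

Lemma expr_shift (m : int) c : s ^ (m + 2%:Z) * (s ^- 2 * c) = s ^ m * c.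
Proof.
rewrite exprzDr // -mulrA; congr (_ * _); exact: mulVKr (unitrX 2 sU) c.
Qed.

(** The exponents add up: [-(i+j) - 2 + (i+1+j) = -1] for [v1], [0] for [v2], and
    [-(i+j) - 2 + (2i+1) = i-j-1] for [v3]. *)
Lemma unscale_w_row (i j : nat) v1 v2 v3 :
  (s ^- (i + j))%:P *:
    ((s ^- 2)%:P *: ((s ^+ (i.+1 + j))%:P *: v1)
     + (1 - (s ^- 2)%:P) *: ((s ^+ (i + j))%:P *: v2)
     - ((s ^- 2)%:P * (1 - (s ^- 2)%:P) * (q ^+ 2)%:P)
       *: ((s ^+ (i + i.+1))%:P *: v3)) =
  (s^-1)%:P *: v1 + (1 - s ^- 2)%:P *: v2
  - (s ^ (i%:Z - j%:Z - 1) * (1 - s ^- 2) * q ^+ 2)%:P *: v3.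
Proof.
rewrite -polyC1 -polyCB -!polyCM scalerBr scalerDr.
rewrite (@scale_exprV_expr _ (i.+1 + j) 1); last by lia.
rewrite (@scale_exprV_expr _ (i + j) 0); last by lia.
rewrite (@scale_exprV_expr _ _ (i%:Z - j%:Z - 1 + 2%:Z)); last by lia.
by rewrite expr_stepV expr0z mul1r -?mulrA expr_shift.
Qed.

Lemma unscale_w_col (i j : nat) v1 v2 v3 :
  (s ^- (j + i))%:P *:
    ((s ^- 2)%:P *: ((s ^+ (j + i.+1))%:P *: v1)
     + (1 - (s ^- 2)%:P) *: ((s ^+ (j + i))%:P *: v2)
     - ((s ^- 2)%:P * (1 - (s ^- 2)%:P)) *: ((s ^+ (i + i.+1))%:P *: v3)) =
  (s^-1)%:P *: v1 + (1 - s ^- 2)%:P *: v2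
  - (s ^ (i%:Z - j%:Z - 1) * (1 - s ^- 2))%:P *: v3.
Proof.
rewrite -polyC1 -polyCB -!polyCM scalerBr scalerDr.
rewrite (@scale_exprV_expr _ (j + i.+1) 1); last by lia.
rewrite (@scale_exprV_expr _ (j + i) 0); last by lia.
rewrite (@scale_exprV_expr _ _ (i%:Z - j%:Z - 1 + 2%:Z)); last by lia.
by rewrite expr_stepV expr0z mul1r -?mulrA expr_shift.
Qed.

Lemma unscale_w_diag (a : nat) v :
  (s ^- a)%:P *: (((s ^- 2)%:P ^+ 2 * (q ^+ 2)%:P) *: ((s ^+ a)%:P *: v)) =
  (s ^- 4 * q ^+ 2)%:P *: v.
Proof.
rewrite -polyC_exp -polyCM (@scale_exprV_expr _ _ 0) ?subrr //.
by rewrite expr0z mul1r -!exprVn -exprM.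
Qed.

Lemma unscale_t (a : nat) (p : {poly R}) v :
  ((s ^- a)%:P * p) *: ((s ^+ a)%:P *: v) = p *: v.
Proof.
by rewrite scalerA mulrAC -polyCM mulVr ?unitrX // mul1r.
Qed.
End Unscaling.

(** * Representations of a presented group from the action of its letters *)

Section PresentedRepresentation.
Variables (X : choiceType) (rels : word X -> word X -> Prop).
Variables (R : nzRingType) (V : lmodType R).
Variable f : X * bool -> {linear V -> V}.

(** The leftmost letter acts last, so concatenation becomes composition and the action is a left
    action. *)
Definition word_act (u : word X) : {linear V -> V} :=
  foldr (fun a (g : {linear V -> V}) => (f a \o g : {linear V -> V})) idfun u.

Lemma word_act_cat u v : word_act (u ++ v) =1 word_act u \o word_act v.
Proof. by elim: u => //= a u IHu z /=; rewrite IHu. Qed.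

Hypothesis fV : forall a, cancel (f (inv_letter a)) (f a).
Hypothesis f_rels : forall u v, rels u v -> word_act u =1 word_act v.

(** Induction on the derivation of [word_eqv]: [f_rels] covers the relations, [fV] the cancelling
    pairs of either sign, and [word_act_cat] the congruence. This makes [presented_act] independent
    of the chosen representative. *)
Lemma word_act_eqv u v : word_eqv rels u v -> word_act u =1 word_act v.
Proof.
elim=> {u v} //.
- by move=> u u' v v' _ Eu _ Ev z; rewrite !word_act_cat /= Ev Eu.
- by move=> u v _ E z; rewrite E.
- by move=> u v y _ Euv _ Evy z; rewrite Euv Evy.
Qed.

Definition presented_act (x : presented rels) : {linear V -> V} :=
  word_act (repr x).

Lemma presented_actE u : presented_act (word_class rels u) =1 word_act u.
Proof. exact/word_act_eqv/word_eqv_repr. Qed.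

Lemma presented_act_representation : is_representation presented_act.
Proof.
split=> [v|x y v]; first exact: presented_actE.
by rewrite presented_actE word_act_cat.
Qed.

Lemma presented_act_gen x : presented_act (presented_gen rels x) =1 f (x, true).
Proof. exact: presented_actE. Qed.

End PresentedRepresentation.

(** * The letters as endomorphisms of the module *)

Section LKBExtension.
Variable n : nat.

Definition lkb_ext (g : lkb_index n -> lkb_module n) (v : lkb_module n) :
  lkb_module n := \sum_z v z *: g z.

Fact lkb_ext_is_linear g : linear (lkb_ext g).
Proof.
move=> a u v; rewrite /lkb_ext scaler_sumr -big_split /=.
by apply: eq_bigr => z _; rewrite !ffunE scalerDl scalerA.
Qed.

HB.instance Definition _ g := GRing.isLinear.Build {poly laurent}
  (lkb_module n) (lkb_module n) *:%R (lkb_ext g) (lkb_ext_is_linear g).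

Lemma lkb_ext_vec g z : lkb_ext g (lkb_vec z) = g z.
Proof.
rewrite /lkb_ext (bigD1 z) //= big1 => [|x xz]; rewrite ffunE.
  by rewrite eqxx addr0 scale1r.
by rewrite (negbTE xz) scale0r.
Qed.

Lemma eq_on_lkb_vec (T U : {linear lkb_module n -> lkb_module n}) :
  (forall z, T (lkb_vec z) = U (lkb_vec z)) -> T =1 U.
Proof.
move=> TU v; rewrite (lkb_vec_span v) !linear_sum.
by apply: eq_bigr => z _; rewrite !linearZZ TU.
Qed.

(** Extended by zero to all natural numbers, to serve as the family [w] of the rescaled action. *)
Definition scaled_w (j k : nat) : lkb_module n :=
  if insub j is Some j' then
    if insub k is Some k' then (ls ^+ (j + k))%:P *: lkb_w j' k' else 0
  else 0.

Lemma scaled_wE (j k : 'I_n) :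
  scaled_w j k = (ls ^+ (j + k))%:P *: lkb_w j k.
Proof. by rewrite /scaled_w !valK. Qed.

Lemma lkb_w_scaled (j k : 'I_n) :
  lkb_w j k = (ls ^- (j + k))%:P *: scaled_w j k.
Proof.
by rewrite scaled_wE scalerA -polyCM mulVr ?unitrX ?ls_unit // scale1r.
Qed.

(** Since [ls] is a unit, the rescaled vectors and [lkb_b] still span. *)
Lemma eq_on_scaled_w (T U : {linear lkb_module n -> lkb_module n}) :
    (forall j k, (j < k < n)%N -> T (scaled_w j k) = U (scaled_w j k)) ->
    T (lkb_b n) = U (lkb_b n) ->
  T =1 U.
Proof.
move=> TUw TUb; apply: eq_on_lkb_vec => -[[[j k] jk]|] //.
have -> : exist _ (j, k) jk =
    Sub (j, k) jk :> {p : 'I_n * 'I_n | (p.1 < p.2)%N} by [].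
by rewrite -lkb_wE lkb_w_scaled !linearZZ TUw // [(j < k)%N]jk ltn_ord.
Qed.

(** [g] prescribes values on the rescaled vectors; the factor [ls ^- (j + k)] turns them into values
    on the basis vectors [lkb_w j k]. *)
Definition scaled_ext (g : nat -> nat -> lkb_module n) (v : lkb_module n) :
    {linear lkb_module n -> lkb_module n} :=
  lkb_ext (fun z =>
    if z is Some p then
      (ls ^- ((\val p).1 + (\val p).2))%:P *: g (\val p).1 (\val p).2
    else v).

Lemma scaled_ext_b g v : scaled_ext g v (lkb_b n) = v.
Proof. exact: lkb_ext_vec. Qed.

Lemma scaled_ext_w g v j k :
  (j < k < n)%N -> scaled_ext g v (scaled_w j k) = g j k.
Proof.
case/andP=> jk kn; have jn := ltn_trans jk kn.
rewrite -[j]/(val (Ordinal jn)) -[k]/(val (Ordinal kn)) scaled_wE.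
rewrite (lkb_wE (jk : (Ordinal jn < Ordinal kn)%N)) linearZZ.
rewrite [scaled_ext _ _ _]lkb_ext_vec /= scalerA -polyCM mulrV ?scale1r //.
by rewrite unitrX ?ls_unit.
Qed.

Let x : {poly laurent} := (ls ^- 2)%:P.
Let y : {poly laurent} := (lq ^+ 2)%:P.
Let xV : {poly laurent} := (ls ^+ 2)%:P.
Let yV : {poly laurent} := (lq ^- 2)%:P.
(** The power of [ls] cancels the one in [scaled_w i i.+1], leaving ['X] times the original
    vector. *)
Let t (i : nat) : {poly laurent} := (ls ^- (i + i.+1))%:P * 'X.

Definition lkb_letter (a : 'I_n.-1 * bool) :
    {linear lkb_module n -> lkb_module n} :=
  if a.2 then
    scaled_ext (scaled_sigma scaled_w x y a.1)
               (lkb_b n + t a.1 *: scaled_w a.1 a.1.+1)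
  else
    scaled_ext (scaled_sigmaV scaled_w x xV yV a.1)
               (lkb_b n - (t a.1 * (xV ^+ 2 * yV)) *: scaled_w a.1 a.1.+1).

Lemma lkb_letter_sigma (i : 'I_n.-1) :
  acts_as_sigma n scaled_w (lkb_b n) x y t i (lkb_letter (i, true)).
Proof.
by split; [move=> j k; exact: scaled_ext_w | exact: scaled_ext_b].
Qed.

Lemma lkb_letter_sigmaV (i : 'I_n.-1) :
  acts_as_sigmaV n scaled_w (lkb_b n) x t xV yV i (lkb_letter (i, false)).
Proof.
by split; [move=> j k; exact: scaled_ext_w | exact: scaled_ext_b].
Qed.

Lemma lkb_letterK a : cancel (lkb_letter (inv_letter a)) (lkb_letter a).
Proof.
have xx : xV * x = 1 by rewrite -polyCM mulrV // unitrX // ls_unit.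
have yy : yV * y = 1 by rewrite -polyCM mulVr // unitrX // lq_unit.
case: a => i e.
have [Kw [Kb Kb']] := sigmaK (linearP _) (linearP _) xx yy
  (strandS_subproof i) (lkb_letter_sigma i) (lkb_letter_sigmaV i).
case: e.
  apply: (@eq_on_scaled_w
    (lkb_letter (i, true) \o lkb_letter (i, false)) idfun) => // j k.
  by case/Kw.
apply: (@eq_on_scaled_w
  (lkb_letter (i, false) \o lkb_letter (i, true)) idfun) => // j k.
by case/Kw.
Qed.

Lemma lkb_letter_rels u v :
  braid_rel u v -> word_act lkb_letter u =1 word_act lkb_letter v.
Proof.
have tS i : t i.+1 = x * t i.
  (* Moving one strand up adds 2 to [i + i.+1], which is the factor [x]. *)
  have -> : t i.+1 = (ls ^- (2 + (i + i.+1)))%:P * 'X.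
    by rewrite /t addSn addnS addnS.
  exact: mul_polyC_exprVD.
case=> i j ij.
  have [Fw Fb] := sigma_far (linearP _) (linearP _) ij (strandS_subproof j)
    (lkb_letter_sigma i) (lkb_letter_sigma j).
  by apply: eq_on_scaled_w => [k l /Fw|]; [exact | exact: Fb].
have jn := strandS_subproof j; have Aj := lkb_letter_sigma j.
(* Only the position becomes [i.+1]; the endomorphism is still that of the ordinal [j]. *)
rewrite {1}ij in jn; rewrite {1}ij in Aj.
have [Nw Nb] :=
  sigma_near tS (linearP _) (linearP _) jn (lkb_letter_sigma i) Aj.
by apply: eq_on_scaled_w => [k l /Nw|]; [exact | exact: Nb].
Qed.

Lemma lkb_letter_w (i : 'I_n.-1) (j k : 'I_n) :
  (j < k)%N ->
  lkb_letter (i, true) (lkb_w j k) =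
    (ls ^- (j + k))%:P *: scaled_sigma scaled_w x y i j k.
Proof.
move=> jk; rewrite lkb_w_scaled linearZZ; congr (_ *: _).
by apply: (lkb_letter_sigma i).1; rewrite jk ltn_ord.
Qed.

End LKBExtension.

(** * The representation and its formulas in the original basis *)

Theorem proposition5p1 (n : nat) (hn : (2 <= n)%N) :
  exists rho : braid n -> {linear lkb_module n -> lkb_module n},
    is_representation rho /\
    forall i : 'I_n.-1,
      let i0 := strand i in
      let i1 := strandS i in
      let act : lkb_module n -> lkb_module n := rho (artin i) in
      let w := @lkb_w n in
      let b := lkb_b n in
      let q := lq in
      let s := ls in
      let t : {poly laurent} := 'X in
      (forall j k : 'I_n, (j < k)%N ->
         j != i0 -> j != i1 -> k != i0 -> k != i1 ->
         act (w j k) = w j k) /\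
      (forall j : 'I_n, (i1 < j)%N ->
         act (w i1 j) = (s^-1)%:P *: w i0 j) /\
      (forall j : 'I_n, (j < i0)%N ->
         act (w j i1) = (s^-1)%:P *: w j i0) /\
      (forall j : 'I_n, (i1 < j)%N ->
         act (w i0 j) =
           (s^-1)%:P *: w i1 j + (1 - s ^- 2)%:P *: w i0 j
           - (s ^ (i0%:Z - j%:Z - 1) * (1 - s ^- 2) * q ^+ 2)%:P *: w i0 i1) /\
      act (w i0 i1) = (s ^- 4 * q ^+ 2)%:P *: w i0 i1 /\
      (forall j : 'I_n, (j < i0)%N ->
         act (w j i0) =
           (s^-1)%:P *: w j i1 + (1 - s ^- 2)%:P *: w j i0
           - (s ^ (i0%:Z - j%:Z - 1) * (1 - s ^- 2))%:P *: w i0 i1) /\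
      act b = b + t *: w i0 i1.
Proof.
exists (presented_act (lkb_letter (n := n))); split.
  exact: presented_act_representation (@lkb_letterK n) (@lkb_letter_rels n).
move=> i i0 i1 act w b q s t.
have actE v : act v = lkb_letter (i, true) v.
  exact: (presented_act_gen (@lkb_letterK n) (@lkb_letter_rels n)).
have i1E : i1 = i.+1 :> nat by [].
have i0E : i0 = i :> nat by [].
have w01 : scaled_w n i i.+1 = (ls ^+ (i + i.+1))%:P *: w i0 i1.
  exact: (scaled_wE i0 i1).
split=> [j k jk ji0 ji1 ki0 ki1|].
  rewrite actE lkb_letter_w // /scaled_sigma.
  rewrite [j == _ :> nat](negbTE ji0) [j == _ :> nat](negbTE ji1).
  rewrite [k == _ :> nat](negbTE ki1) [k == _ :> nat](negbTE ki0).
  by rewrite -lkb_w_scaled.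
split=> [j ij|].
  rewrite actE lkb_letter_w // /scaled_sigma i1E eqxx.
  have -> : (i.+1 == i) = false by lia.
  (* The factors [s^-(i+1+j)] and [s^(i+j)] of the two bases combine to [s^-1]. *)
  rewrite -i0E scaled_wE; exact: (scale_exprV_step ls_unit).
split=> [j ij|].
  have ji1 : (j < i1)%N by lia.
  rewrite actE lkb_letter_w // /scaled_sigma i1E eqxx.
  have -> : (j == i :> nat) = false by lia.
  have -> : (j == i.+1 :> nat) = false by lia.
  rewrite -i0E scaled_wE addnS; exact: (scale_exprV_step ls_unit).
split=> [j ij|].
  have i0j : (i0 < j)%N by lia.
  rewrite actE lkb_letter_w // /scaled_sigma i0E eqxx.
  have -> : (j == i.+1 :> nat) = false by lia.
  rewrite w01 -[i.+1]i1E scaled_wE -i0E scaled_wE.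
  exact: (unscale_w_row _ ls_unit).
split.
  rewrite actE lkb_letter_w; last exact: ltnSn.
  rewrite /scaled_sigma [i0 == _ :> nat]eqxx [i1 == _ :> nat]eqxx w01.
  exact: (unscale_w_diag _ ls_unit).
split=> [j ij|].
  rewrite actE lkb_letter_w // /scaled_sigma i0E eqxx.
  have -> : (j == i :> nat) = false by lia.
  have -> : (j == i.+1 :> nat) = false by lia.
  have -> : (i == i.+1 :> nat) = false by lia.
  rewrite w01 -[i.+1]i1E scaled_wE -i0E scaled_wE.
  exact: (unscale_w_col ls_unit).
rewrite actE (lkb_letter_sigma i).2 w01; congr (_ + _).
exact: (unscale_t ls_unit).
Qed.
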